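(* Let $A$ and $\Delta A$ be real $m\times n$ matrices with $\mathrm{rank}(A)=n$ and $\|\Delta A\|_2\|A^\dagger\|_2\le 1/2$. Let $\ell_j$ and $\tilde{\ell}_j$, $1\le j\le m$, be the leverage scores of $A$ and $A+\Delta A$, respectively, and let $$\epsilon=\frac{\|\Delta A\|_2}{\|A\|_2},\qquad \epsilon^{\perp}=\frac{\|(I_m-AA^\dagger)\,\Delta A\|_2}{\|A\|_2}.$$ Then for every $1\le j\le m$ with $\ell_j>0$, $$\frac{|\tilde{\ell}_j-\ell_j|}{\ell_j}\le 4\left(\sqrt{\frac{1-\ell_j}{\ell_j}}+\frac{\kappa_2(A)}{\ell_j}\,\epsilon^{\perp}\right)\kappa_2(A)\,\epsilon^{\perp}$$ and $$\frac{|\tilde{\ell}_j-\ell_j|}{\ell_j}\le \left(2\sqrt{\frac{1-\ell_j}{\ell_j}}+\frac{\kappa_2(A)}{\ell_j}\,\epsilon\right)\kappa_2(A)\,\epsilon.$$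
   Context: Leverage scores: if $A$ is a real $m\times n$ matrix with $\mathrm{rank}(A)=n$ and $Q$ is any $m\times n$ matrix whose columns form an orthonormal basis of $\mathrm{range}(A)$, the leverage scores of $A$ are $\ell_j=\|e_j^TQ\|_2^2$, $1\le j\le m$, where $e_j$ is the $j$th column of the $m\times m$ identity $I_m$ (this is independent of the choice of $Q$). $\|\cdot\|_2$ is the spectral norm of a matrix (Euclidean norm of a vector), $A^\dagger$ is the Moore-Penrose inverse, and $\kappa_2(A)=\|A\|_2\|A^\dagger\|_2$. The hypothesis $\|\Delta A\|_2\|A^\dagger\|_2\le 1/2$ implies $\mathrm{rank}(A+\Delta A)=n$, so $\tilde{\ell}_j$ is well defined. *)

(* Defs.v *)
From HB Require Import structures.
From mathcomp Require Import all_boot all_order all_algebra.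
From mathcomp Require Import boolp classical_sets reals.

Set Implicit Arguments.
Unset Strict Implicit.
Unset Printing Implicit Defensive.

Import Order.TTheory GRing.Theory Num.Theory.

Local Open Scope classical_set_scope.
Local Open Scope ring_scope.

(* The library norm on matrices is the maximum of the absolute entries, not the
   Euclidean or spectral norm. *)
Definition enorm (R : realType) (n : nat) (x : 'cV[R]_n) : R :=
  Num.sqrt (\sum_(i < n) x i 0 ^+ 2).

(* For n = 0 the set is empty and [sup] returns 0, the right value. *)
Definition spectral_norm (R : realType) (m n : nat) (A : 'M[R]_(m, n)) : R :=
  sup [set enorm (A *m x) | x in [set x : 'cV[R]_n | enorm x = 1]].

Definition penrose (R : realType) (m n : nat)
    (A : 'M[R]_(m, n)) (X : 'M[R]_(n, m)) : Prop :=
  [/\ A *m X *m A = A, X *m A *m X = X,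
      (A *m X)^T = A *m X & (X *m A)^T = X *m A].

(* [pinvmx] of mxalgebra is only a generalised inverse; see [mpinvP] and
   [mpinv_unique] below. *)
Definition mpinv (R : realType) (m n : nat) (A : 'M[R]_(m, n)) : 'M[R]_(n, m) :=
  xget 0 [set X | penrose A X].

Definition cond2 (R : realType) (m n : nat) (A : 'M[R]_(m, n)) : R :=
  spectral_norm A * spectral_norm (mpinv A).

(* MathComp's %MS relations compare row spaces, hence the transposes:
   range(Q) = range(A). *)
Definition orthonormal_basis_range (R : realType) (m n : nat)
    (A Q : 'M[R]_(m, n)) : Prop :=
  Q^T *m Q = 1%:M /\ (Q^T == A^T)%MS.

(* Meaningful when \rank A = n: such a Q then exists, and the value does not
   depend on it (see [leverageE] and [orthonormal_basis_range_exists]). *)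
Definition leverage (R : realType) (m n : nat) (A : 'M[R]_(m, n)) (j : 'I_m) : R :=
  let Q := xget 0 [set Q | orthonormal_basis_range A Q] in
  enorm (row j 1%:M *m Q)^T ^+ 2.

Lemma enorm_sqr (R : realType) n (x : 'cV[R]_n) : enorm x ^+ 2 = (x^T *m x) 0 0.
Proof.
rewrite /enorm sqr_sqrtr; last by apply: sumr_ge0 => i _; exact: sqr_ge0.
by rewrite mxE; apply: eq_bigr => i _; rewrite mxE expr2.
Qed.

Lemma mulmx_tr_eq0 (R : realType) n (v : 'rV[R]_n) : (v *m v^T) 0 0 = 0 -> v = 0.
Proof.
move=> /eqP; rewrite mxE psumr_eq0; last first.
  by move=> i _; rewrite mxE -expr2 sqr_ge0.
move=> /allP v0; apply/rowP => i; rewrite [RHS]mxE.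
by have := v0 i (mem_index_enum i); rewrite /= mxE -expr2 sqrf_eq0 => /eqP.
Qed.

Lemma mulmx_tr_ge0 (R : realType) n (v : 'rV[R]_n) : 0 <= (v *m v^T) 0 0.
Proof. by rewrite mxE sumr_ge0 // => i _; rewrite mxE -expr2 sqr_ge0. Qed.

Lemma gram_unit (R : realType) p q (B : 'M[R]_(p, q)) : row_free B -> B *m B^T \in unitmx.
Proof.
move=> fB; rewrite -row_free_unit; apply/row_freeP.
have : kermx (B *m B^T) = 0.
  apply/row_matrixP => i; rewrite row0.
  set x := row i _.
  have x0 : x *m (B *m B^T) = 0.
    by rewrite /x -row_mul mulmx_ker row0.
  have xB0 : x *m B = 0.
    by apply: mulmx_tr_eq0; rewrite trmx_mul mulmxA -(mulmxA x) x0 mul0mx mxE.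
  by apply: (row_free_inj fB); rewrite xB0 mul0mx.
by move=> /eqP; rewrite kermx_eq0 => /row_freeP.
Qed.

Lemma penrose_factor (R : realType) m r n (C : 'M[R]_(m, r)) (B : 'M[R]_(r, n)) :
  row_free B -> row_free C^T -> exists X, penrose (C *m B) X.
Proof.
move=> /gram_unit fB /gram_unit; rewrite trmxK => fC.
exists (B^T *m invmx (B *m B^T) *m (invmx (C^T *m C) *m C^T)).
set G := B *m B^T in fB *; set H := C^T *m C in fC *.
have GT : (invmx G)^T = invmx G by rewrite trmx_inv /G trmx_mul trmxK.
have HT : (invmx H)^T = invmx H by rewrite trmx_inv /H trmx_mul trmxK.
set X := _ *m (_ *m _).
have AX : C *m B *m X = C *m invmx H *m C^T.
  rewrite /X !mulmxA -(mulmxA C B) -/G -(mulmxA C G) mulmxV // mulmx1.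
  by rewrite -!mulmxA.
have XA : X *m (C *m B) = B^T *m invmx G *m B.
  rewrite /X !mulmxA -(mulmxA _ C^T C) -/H -(mulmxA _ (invmx H) H).
  by rewrite mulVmx // mulmx1.
split.
- rewrite AX !mulmxA -(mulmxA _ C^T C) -/H -(mulmxA _ (invmx H) H).
  by rewrite mulVmx // mulmx1.
- rewrite XA /X !mulmxA -(mulmxA _ B B^T) -/G -(mulmxA _ (invmx G) G).
  by rewrite mulVmx // mulmx1.
- by rewrite AX !trmx_mul trmxK HT mulmxA.
- by rewrite XA !trmx_mul trmxK GT mulmxA.
Qed.

Lemma penrose_exists (R : realType) m n (A : 'M[R]_(m, n)) : exists X, penrose A X.
Proof.
have := @penrose_factor _ _ _ _ (col_base A) (row_base A).
rewrite mulmx_base; apply; first exact: row_base_free.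
by rewrite /row_free mxrank_tr; exact: col_base_full.
Qed.

Lemma mpinvP (R : realType) m n (A : 'M[R]_(m, n)) : penrose A (mpinv A).
Proof. by rewrite /mpinv; apply: (@xgetPex _ 0); exact: penrose_exists. Qed.

Lemma penrose_unique (R : realType) m n (A : 'M[R]_(m, n)) X Y :
  penrose A X -> penrose A Y -> X = Y.
Proof.
move=> [X1 X2 X3 X4] [Y1 Y2 Y3 Y4].
have AXY : A *m X = A *m Y.
  rewrite -{1}Y1 -(mulmxA _ A X) -X3 -Y3 -trmx_mul mulmxA X1.
  by rewrite Y3.
have XYA : X *m A = Y *m A.
  rewrite -{1}Y1 mulmxA mulmxA -(mulmxA (X *m A)) -X4 -Y4 -trmx_mul.
  by rewrite -mulmxA (mulmxA A) X1 Y4.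
by rewrite -X2 -mulmxA AXY mulmxA XYA.
Qed.

Lemma mpinv_unique (R : realType) m n (A : 'M[R]_(m, n)) X : penrose A X -> mpinv A = X.
Proof. by move=> AX; apply: penrose_unique AX; exact: mpinvP. Qed.

Lemma gram_schmidt (R : realType) n q (A : 'M[R]_(n, q)) : row_free A ->
  exists Q : 'M[R]_(n, q), Q *m Q^T = 1%:M /\ (Q == A)%MS.
Proof.
elim: n A => [|n IHn] A fA.
  by exists A; split; [apply/matrixP => -[] | rewrite submx_refl].
pose a := usubmx (A : 'M_(1 + n, q)); pose B := dsubmx (A : 'M_(1 + n, q)).
have AE : A = col_mx a B by rewrite vsubmxK.
have rA : \rank (col_mx a B) = n.+1 by rewrite -AE; exact/eqP.
have fB : row_free B.
  rewrite /row_free eqn_leq rank_leq_row -ltnS -[X in (X <= _)%N]rA.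
  rewrite -addsmxE (leq_trans (mxrank_adds_leqif _ _)) //.
  by rewrite -[leqRHS]add1n leq_add2r; exact: rank_leq_row.
have [Q0 [Q01 /eqmxP eQB]] := IHn B fB.
pose v := a - a *m Q0^T *m Q0.
have vQ : v *m Q0^T = 0.
  by rewrite /v mulmxBl -(mulmxA _ Q0) Q01 mulmx1 subrr.
have v0 : v != 0.
  apply/eqP => /eqP; rewrite subr_eq0 => /eqP av.
  have aB : (a <= B)%MS by rewrite -eQB av submxMl.
  have := rA; rewrite -addsmxE (addsmx_idPr aB) => rB.
  by have := rank_leq_row B; rewrite rB ltnn.
pose s := (v *m v^T) 0 0.
have s0 : 0 < s.
  rewrite lt_neqAle eq_sym; apply/andP; split.
    by apply: contra_neq v0 => /mulmx_tr_eq0.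
  exact: mulmx_tr_ge0.
pose c := (Num.sqrt s)^-1.
pose Q := col_mx (c *: v) Q0.
have QQ : Q *m Q^T = 1%:M.
  have cvQ : c *: v *m Q0^T = 0 by rewrite -scalemxAl vQ scaler0.
  rewrite /Q tr_col_mx mul_col_row cvQ Q01.
  have -> : Q0 *m (c *: v)^T = 0.
    by rewrite -[Q0]trmxK -trmx_mul cvQ trmx0.
  have -> : c *: v *m (c *: v)^T = 1%:M.
    apply/matrixP => i j; rewrite !ord1.
    rewrite linearZ /= -scalemxAr -scalemxAl scalerA mxE -/s [RHS]mxE eqxx.
    by rewrite -expr2 /c exprVn sqr_sqrtr ?ltW // mulVf // gt_eqF.
  by rewrite -scalar_mx_block.
exists Q; split => //.
have QA : (Q <= A)%MS.
  have /andP[aA BA] : (a <= A)%MS && (B <= A)%MS by rewrite -col_mx_sub -AE.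
  rewrite /Q col_mx_sub eQB BA andbT scalemx_sub // /v addmx_sub //.
  by rewrite eqmx_opp (submx_trans (submxMl _ _)) // eQB.
have fQ : row_free Q by apply/row_freeP; exists Q^T.
rewrite -(mxrank_leqif_eq QA); move: fQ fA.
by rewrite /row_free => /eqP -> /eqP ->.
Qed.

Lemma orthonormal_basis_range_exists (R : realType) m n (A : 'M[R]_(m, n)) :
  \rank A = n -> exists Q, orthonormal_basis_range A Q.
Proof.
move=> rA; have fA : row_free A^T by rewrite /row_free mxrank_tr rA.
have [Q [Q1 QA]] := gram_schmidt fA.
by exists Q^T; split; rewrite trmxK.
Qed.

Lemma leverageE (R : realType) m n (A Q : 'M[R]_(m, n)) j :
  orthonormal_basis_range A Q -> leverage A j = enorm (row j Q)^T ^+ 2.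
Proof.
move=> AQ; rewrite /leverage.
have /= := @xgetI _ 0 [set Q | orthonormal_basis_range A Q] Q AQ.
set P := xget _ _ => -[P1 /eqmxP PA]; case: AQ => Q1 /eqmxP QA.
rewrite -row_mul mul1mx !enorm_sqr !trmxK.
have /submxP[D PE] : (P^T <= Q^T)%MS by rewrite PA QA.
have {}PE : P = Q *m D^T by rewrite -[P]trmxK PE trmx_mul trmxK.
have DD : D *m D^T = 1%:M.
  by rewrite -P1 PE trmx_mul trmxK mulmxA -(mulmxA D) Q1 mulmx1.
have DD' := mulmx1C DD.
by rewrite PE row_mul trmx_mul trmxK mulmxA -(mulmxA (row j Q)) DD' mulmx1.
Qed.

(* Main.v *)
(** Let Pi and Pi' be the orthogonal projectors onto range(A) and range(A + dA),
    so that the leverage scores of row j are |Pi e_j|^2 and |Pi' e_j|^2.  Since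
    the two ranges have the same dimension, |(I - Pi') Pi| = |(I - Pi) Pi'|; call
    it s.  Splitting e_j along range(A) and its complement gives
      | |Pi' e_j|^2 - l | <= 2 sqrt (l (1 - l)) s + s^2,  where l = |Pi e_j|^2.
    It remains to bound s.  From (I - Pi') A = - (I - Pi') dA one gets
    s <= |dA| |A^+|, and from (I - Pi) (A + dA) = (I - Pi) dA, together with
    |A x| <= 2 |(A + dA) x|, one gets s <= 2 |(I - Pi) dA| |A^+|. *)

Require Import Defs.
From mathcomp Require Import all_boot all_order all_algebra.
From mathcomp Require Import boolp reals.
From mathcomp Require Import ring lra.

Import Order.TTheory GRing.Theory Num.Theory.
Local Open Scope ring_scope.

(** * Euclidean inner product and norm on column vectors *)

Definition dotv {R : realType} {n : nat} (x y : 'cV[R]_n) : R := (x^T *m y) 0 0.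

Section DotProduct.
Context {R : realType}.

Lemma dotvC n (x y : 'cV[R]_n) : dotv x y = dotv y x.
Proof. by rewrite /dotv -[x^T *m y]trmxK trmx_mul trmxK mxE. Qed.

Lemma dotvDr n (x y z : 'cV[R]_n) :
  dotv x (y + z) = dotv x y + dotv x z.
Proof. by rewrite /dotv mulmxDr mxE. Qed.

Lemma dotvNr n (x y : 'cV[R]_n) : dotv x (- y) = - dotv x y.
Proof. by rewrite /dotv mulmxN mxE. Qed.

Lemma dotvZr n a (x y : 'cV[R]_n) : dotv x (a *: y) = a * dotv x y.
Proof. by rewrite /dotv -scalemxAr mxE. Qed.

Lemma dotvDl n (x y z : 'cV[R]_n) :
  dotv (x + y) z = dotv x z + dotv y z.
Proof. by rewrite dotvC dotvDr !(dotvC n z). Qed.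

Lemma dotvNl n (x y : 'cV[R]_n) : dotv (- x) y = - dotv x y.
Proof. by rewrite dotvC dotvNr dotvC. Qed.

Lemma dotvZl n a (x y : 'cV[R]_n) : dotv (a *: x) y = a * dotv x y.
Proof. by rewrite dotvC dotvZr dotvC. Qed.

Lemma dotv_mulmx m n (A : 'M[R]_(m, n)) x y :
  dotv x (A *m y) = dotv (A^T *m x) y.
Proof. by rewrite /dotv trmx_mul trmxK mulmxA. Qed.

Lemma dotvv n (x : 'cV[R]_n) : dotv x x = enorm x ^+ 2.
Proof. by rewrite enorm_sqr. Qed.

Lemma enorm_ge0 n (x : 'cV[R]_n) : 0 <= enorm x.
Proof. exact: sqrtr_ge0. Qed.

Lemma enorm_eq0 n (x : 'cV[R]_n) : enorm x = 0 -> x = 0.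
Proof.
move=> x0; apply: trmx_inj; rewrite trmx0; apply: mulmx_tr_eq0.
by rewrite trmxK -enorm_sqr x0 expr0n.
Qed.

Lemma enorm0 n : enorm (0 : 'cV[R]_n) = 0.
Proof. by apply/eqP; rewrite -sqrf_eq0 -dotvv /dotv mulmx0 mxE. Qed.

Lemma enormZ n a (x : 'cV[R]_n) : enorm (a *: x) = `|a| * enorm x.
Proof.
apply/eqP; rewrite -(@eqrXn2 _ 2) ?mulr_ge0 ?enorm_ge0 //.
by rewrite exprMn -!dotvv dotvZl dotvZr real_normK ?num_real // expr2 mulrA.
Qed.

Lemma enormN n (x : 'cV[R]_n) : enorm (- x) = enorm x.
Proof. by rewrite -scaleN1r enormZ normrN1 mul1r. Qed.

(** Cauchy-Schwarz: expand [0 <= | |y| x - |x| y |^2] and cancel [|x| |y|], zero vectors being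
    treated apart. *)
Lemma ler_dotv n (x y : 'cV[R]_n) : dotv x y <= enorm x * enorm y.
Proof.
have [y0|] := eqVneq (enorm y) 0.
  by rewrite y0 mulr0 (enorm_eq0 _ _ y0) /dotv mulmx0 mxE.
have [x0 _|xN0 yN0] := eqVneq (enorm x) 0.
  by rewrite x0 mul0r (enorm_eq0 _ _ x0) dotvC /dotv mulmx0 mxE.
have xgt0 : 0 < enorm x by rewrite lt_neqAle eq_sym xN0 enorm_ge0.
have ygt0 : 0 < enorm y by rewrite lt_neqAle eq_sym yN0 enorm_ge0.
have := sqr_ge0 (enorm (enorm y *: x - enorm x *: y)).
rewrite -dotvv dotvDl !dotvDr !dotvNl !dotvNr !dotvZl !dotvZr (dotvC n y x).
rewrite !dotvv => h.
rewrite -(ler_pM2l (mulr_gt0 xgt0 ygt0)); move: h.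
by move: (enorm x) (enorm y) (dotv _ _) => a b c; lra.
Qed.

Lemma ler_norm_dotv n (x y : 'cV[R]_n) : `|dotv x y| <= enorm x * enorm y.
Proof. by rewrite ler_norml lerNl -dotvNl -{1}(enormN n x) !ler_dotv. Qed.

Lemma enormD_sqr n (x y : 'cV[R]_n) :
  enorm (x + y) ^+ 2 = enorm x ^+ 2 + enorm y ^+ 2 + 2 * dotv x y.
Proof. by rewrite -dotvv dotvDl !dotvDr (dotvC n y x) !dotvv; ring. Qed.

Lemma ler_enormD n (x y : 'cV[R]_n) : enorm (x + y) <= enorm x + enorm y.
Proof.
rewrite -(@ler_pXn2r _ 2) ?nnegrE ?addr_ge0 ?enorm_ge0 //.
rewrite enormD_sqr.
by have := ler_dotv n x y; lra.
Qed.

Lemma enorm_isometry m n (Q : 'M[R]_(m, n)) x :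
  Q^T *m Q = 1%:M -> enorm (Q *m x) = enorm x.
Proof.
move=> QQ; apply/eqP; rewrite -(@eqrXn2 _ 2) ?enorm_ge0 //.
by rewrite -!dotvv dotv_mulmx mulmxA QQ mul1mx.
Qed.

End DotProduct.

(** * The spectral norm as an operator bound *)

Section SpectralNorm.
Context {R : realType}.

(** Ensures that the [sup] defining the spectral norm is a genuine supremum. Cauchy-Schwarz on each
    row bounds [|A x|^2] by the squared Frobenius norm. *)
Lemma enorm_mulmx_bounded m n (A : 'M[R]_(m, n)) :
  exists M, forall x, enorm x = 1 -> enorm (A *m x) <= M.
Proof.
(* Adding 1 avoids a square root, since [t <= t^2 + 1]. *)
exists (\sum_i enorm (row i A)^T ^+ 2 + 1) => x x1.
have Ax2 : enorm (A *m x) ^+ 2 <= \sum_i enorm (row i A)^T ^+ 2.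
  rewrite {1}/enorm sqr_sqrtr ?sumr_ge0 // => [|i _]; last exact: sqr_ge0.
  apply: ler_sum => i _.
  have -> : (A *m x) i 0 = dotv (row i A)^T x.
    by rewrite /dotv trmxK -row_mul [RHS]mxE.
  rewrite -[leLHS]real_normK ?num_real //.
  rewrite ler_pXn2r ?nnegrE ?normr_ge0 ?enorm_ge0 //.
  by rewrite -[leRHS]mulr1 -x1 ler_norm_dotv.
have := enorm_ge0 _ (A *m x); have := sqr_ge0 (enorm (A *m x) - 1); lra.
Qed.

Lemma enorm_mulmx m n (A : 'M[R]_(m, n)) x :
  enorm (A *m x) <= spectral_norm A * enorm x.
Proof.
have [x0|xN0] := eqVneq (enorm x) 0.
  by rewrite x0 mulr0 (enorm_eq0 _ _ x0) mulmx0 enorm0.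
have xgt0 : 0 < enorm x by rewrite lt_neqAle eq_sym xN0 enorm_ge0.
have y1 : enorm ((enorm x)^-1 *: x) = 1.
  by rewrite enormZ ger0_norm ?invr_ge0 ?ltW // mulVf.
have [M hM] := enorm_mulmx_bounded _ _ A.
have : enorm (A *m ((enorm x)^-1 *: x)) <= spectral_norm A.
  apply: ub_le_sup; last by exists ((enorm x)^-1 *: x).
  by exists M => _ [z z1 <-]; exact: hM.
rewrite -scalemxAr enormZ ger0_norm ?invr_ge0 ?(ltW xgt0) //.
by rewrite ler_pdivrMl // mulrC.
Qed.

Lemma spectral_norm_ge0 m n (A : 'M[R]_(m, n)) : 0 <= spectral_norm A.
Proof.
have [[x x1]|no] := pselect (exists x : 'cV[R]_n, enorm x = 1).
  by have := enorm_mulmx _ _ A x; rewrite x1 mulr1; exact: le_trans (enorm_ge0 _ _).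
(* Without unit vectors the set is empty and [sup] takes its default value 0. *)
rewrite /spectral_norm sup_out // => -[[_ [x x1 _]] _].
by apply: no; exists x.
Qed.

Lemma mulmx_cV_inj m n (A B : 'M[R]_(m, n)) :
  (forall x : 'cV_n, A *m x = B *m x) -> A = B.
Proof.
by move=> AB; apply/matrixP => i j; have /colP/(_ i) := AB (delta_mx j 0);
   rewrite -!colE !mxE.
Qed.

Lemma spectral_norm_eq0 m n (A : 'M[R]_(m, n)) : spectral_norm A = 0 -> A = 0.
Proof.
move=> A0; apply: mulmx_cV_inj => x; rewrite mul0mx.
apply: enorm_eq0; apply/eqP; rewrite eq_le enorm_ge0 andbT.
by rewrite (le_trans (enorm_mulmx _ _ _ _)) // A0 mul0r.
Qed.

End SpectralNorm.

(** * Orthogonal projectors onto subspaces of equal dimension *)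

Section SubspaceDistance.
Context {R : realType} {m n : nat}.

(** Pythagoras for the orthogonal projector [Q Q^T]. *)
Lemma enorm_proj_compl (Q : 'M[R]_(m, n)) x : Q^T *m Q = 1%:M ->
  enorm (x - Q *m (Q^T *m x)) ^+ 2 = enorm x ^+ 2 - enorm (Q^T *m x) ^+ 2.
Proof.
move=> QQ; rewrite -dotvv dotvDl !dotvDr !dotvNl !dotvNr !dotvv.
by rewrite (dotvC _ (Q *m _) x) dotv_mulmx dotvv (enorm_isometry _ _ Q) //; ring.
Qed.

(* [Q^T *m P] is square: if its transpose is bounded below by [c > 0], then it
   is invertible and is bounded below by the same [c]. *)
Lemma proj_dist_sym (P Q : 'M[R]_(m, n)) (s : R) : 0 <= s ->
  P^T *m P = 1%:M -> Q^T *m Q = 1%:M ->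
  (forall x, enorm (Q *m x - P *m (P^T *m (Q *m x))) <= s * enorm x) ->
  forall x, enorm (P *m x - Q *m (Q^T *m (P *m x))) <= s * enorm x.
Proof.
move=> s0 PP QQ hQ x.
rewrite -(@ler_pXn2r _ 2) ?nnegrE ?mulr_ge0 ?enorm_ge0 //.
rewrite enorm_proj_compl // (enorm_isometry _ _ _ _) // exprMn.
(* For [s >= 1] the bound is trivial, as projecting does not increase the norm. *)
have [s1|s1] := leP 1 (s ^+ 2).
  by have := sqr_ge0 (enorm (Q^T *m (P *m x)));
     have := ler_wpM2r (sqr_ge0 (enorm x)) s1; lra.
pose C := P^T *m Q.
have lowC y : (1 - s ^+ 2) * enorm y ^+ 2 <= enorm (C *m y) ^+ 2.
  have := hQ y; rewrite -(@ler_pXn2r _ 2) ?nnegrE ?mulr_ge0 ?enorm_ge0 //.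
  by rewrite enorm_proj_compl // (enorm_isometry _ _ _ _) // exprMn -mulmxA; lra.
(* The lower bound, with [1 - s^2 > 0], makes the square matrix [C] injective. *)
have Cunit : C \in unitmx.
  rewrite -unitmx_tr -row_free_unit -kermx_eq0; apply/eqP/row_matrixP => i.
  rewrite row0; apply: trmx_inj; rewrite trmx0; apply: enorm_eq0.
  set z := (row _ _)^T.
  have Cz : C *m z = 0.
    by rewrite -[C]trmxK -trmx_mul -row_mul mulmx_ker row0 trmx0.
  have := lowC z; rewrite Cz enorm0 expr0n /=.
  rewrite pmulr_rle0 ?subr_gt0 // => z0; apply/eqP; rewrite -sqrf_eq0.
  by rewrite eq_le z0 sqr_ge0.
have -> : Q^T *m (P *m x) = C^T *m x by rewrite /C trmx_mul trmxK mulmxA.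
set y := invmx C *m x.
have xE : x = C *m y by rewrite mulKVmx.
have := lowC y; rewrite -xE => lowy.
(* Duality moves the lower bound from [C] to [C^T]: [|x|^2 = x . C y = (C^T x) . y], while
   [(1 - s^2) |y|^2 <= |x|^2]. *)
have : enorm x ^+ 2 <= enorm (C^T *m x) * enorm y.
  by rewrite -dotvv {2}xE dotv_mulmx ler_dotv.
move: lowy s1 (enorm_ge0 _ x) (enorm_ge0 _ y) (enorm_ge0 _ (C^T *m x)).
move: (enorm x) (enorm y) (enorm (C^T *m x)) (s ^+ 2) => a b d t lowy t1 a0 b0 d0 had.
have [->|aN0] := eqVneq a 0; first by rewrite expr0n /=; have := sqr_ge0 d; lra.
have agt0 : 0 < a ^+ 2 by rewrite exprn_gt0 // lt_neqAle eq_sym aN0.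
suff : (1 - t) * a ^+ 2 <= d ^+ 2 by lra.
rewrite -(ler_pM2r agt0).
apply: (le_trans (y := d ^+ 2 * ((1 - t) * b ^+ 2))); last first.
  by rewrite ler_wpM2l ?sqr_ge0.
have : (a ^+ 2) ^+ 2 <= (d * b) ^+ 2.
  by rewrite ler_pXn2r ?nnegrE ?mulr_ge0 ?sqr_ge0.
have t0 : 0 <= 1 - t by lra.
by move=> /(ler_wpM2l t0); rewrite exprMn; lra.
Qed.

(* Taking [u := Q Q^T e], [v := e - u] and [w := u - P P^T u],
   [|P^T e|^2 - |Q^T e|^2 = |P^T v|^2 - |w|^2 - 2 w.v]. *)
Lemma proj_norm_diff (P Q : 'M[R]_(m, n)) (s : R) (e : 'cV_m) : 0 <= s ->
  P^T *m P = 1%:M -> Q^T *m Q = 1%:M -> enorm e = 1 ->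
  (forall x, enorm (Q *m x - P *m (P^T *m (Q *m x))) <= s * enorm x) ->
  let l := enorm (Q^T *m e) ^+ 2 in
  l <= 1 /\
  `|enorm (P^T *m e) ^+ 2 - l| <= 2 * Num.sqrt (l * (1 - l)) * s + s ^+ 2.
Proof.
move=> s0 PP QQ e1 hQ l; have hP := proj_dist_sym _ _ _ s0 PP QQ hQ.
pose u := Q *m (Q^T *m e); pose v : 'cV_m := e - u.
pose w : 'cV_m := u - P *m (P^T *m u); pose y := P^T *m v.
have v2 : enorm v ^+ 2 = 1 - l by rewrite enorm_proj_compl // e1 expr1n.
have l1 : l <= 1 by have := sqr_ge0 (enorm v); lra.
split=> //.
have eE : e = u + v by rewrite /v addrC subrK.
have Qv : Q^T *m v = 0.
  by rewrite /v /u mulmxBr (mulmxA Q^T Q) QQ mul1mx subrr.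
have u2 : enorm u ^+ 2 = l by rewrite enorm_isometry.
have w2 : enorm w ^+ 2 = l - enorm (P^T *m u) ^+ 2 by rewrite enorm_proj_compl // u2.
have wl : enorm w <= s * enorm (Q^T *m e) by exact: hQ.
have uv : dotv u v = 0.
  by rewrite dotvC dotv_mulmx Qv /dotv trmx0 mul0mx mxE.
(* [P P^T u = u - w], and [u] is orthogonal to [v]. *)
have PuPv : dotv (P^T *m u) y = - dotv w v.
  by rewrite dotvDl uv dotvNl add0r opprK [RHS]dotvC dotv_mulmx dotvC.
have yv : enorm y <= s * enorm v.
  have [->|yN0] := eqVneq (enorm y) 0; first by rewrite mulr_ge0 ?enorm_ge0.
  have ygt0 : 0 < enorm y by rewrite lt_neqAle eq_sym yN0 enorm_ge0.
  rewrite -(ler_pM2r ygt0) -expr2 -dotvv {1}/y -dotv_mulmx.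
  (* As [v] is orthogonal to range(Q), only the component of [P y] off range(Q) counts, and [hP]
     bounds it by [s |y|]. *)
  have -> : dotv v (P *m y) = dotv v (P *m y - Q *m (Q^T *m (P *m y))).
    by rewrite dotvDr dotvNr (dotv_mulmx _ _ Q) Qv [dotv 0 _]/dotv trmx0 mul0mx mxE subr0.
  apply: (le_trans (ler_dotv _ _ _)).
  by have := ler_wpM2l (enorm_ge0 _ v) (hP y); lra.
have -> : enorm (P^T *m e) ^+ 2 - l
    = enorm y ^+ 2 - enorm w ^+ 2 - 2 * dotv w v.
  rewrite w2 {1}eE mulmxDr -/y enormD_sqr PuPv.
  by ring.
have lvE : Num.sqrt (l * (1 - l)) = enorm (Q^T *m e) * enorm v.
  rewrite -v2 -exprMn sqrtr_sqr ger0_norm // mulr_ge0 ?enorm_ge0 //.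
have wv : `|dotv w v| <= Num.sqrt (l * (1 - l)) * s.
  apply: (le_trans (ler_norm_dotv _ _ _)).
  by rewrite lvE; have := ler_wpM2r (enorm_ge0 _ v) wl; lra.
have y2s : enorm y ^+ 2 <= s ^+ 2.
  have l0 : 0 <= l by exact: sqr_ge0.
  have : enorm y ^+ 2 <= (s * enorm v) ^+ 2.
    by rewrite ler_pXn2r ?nnegrE ?mulr_ge0 ?enorm_ge0.
  rewrite exprMn v2; have := mulr_ge0 (sqr_ge0 s) l0; lra.
have w2s : enorm w ^+ 2 <= s ^+ 2.
  have : enorm w ^+ 2 <= (s * enorm (Q^T *m e)) ^+ 2.
    by rewrite ler_pXn2r ?nnegrE ?mulr_ge0 ?enorm_ge0.
  rewrite exprMn -/l; have l'0 : 0 <= 1 - l by lra.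
  by have := mulr_ge0 (sqr_ge0 s) l'0; lra.
(* Both squares lie in [[0, s^2]], so their difference costs [s^2] and not [2 s^2]. *)
move: wv; rewrite !ler_norml => /andP[wv1 wv2].
have := sqr_ge0 (enorm y); have := sqr_ge0 (enorm w).
by move=> ? ?; apply/andP; split; lra.
Qed.

End SubspaceDistance.

(** * Pseudoinverse and projector for full column rank *)

Section Perturbation.
Context {R : realType} {m n : nat}.

(** Full column rank allows cancelling [A] on the left in [A A^+ A = A]. *)
Lemma mpinv_mulVmx (A : 'M[R]_(m, n)) : \rank A = n -> mpinv A *m A = 1%:M.
Proof.
move=> rA; have [A1 _ _ _] := mpinvP A.
have fA : row_free A^T by rewrite /row_free mxrank_tr rA.
apply: trmx_inj; apply: (row_free_inj fA).
by rewrite /= -!trmx_mul mulmxA A1 mulmx1.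
Qed.

Lemma enorm_le_mpinv (A : 'M[R]_(m, n)) x : \rank A = n ->
  enorm x <= spectral_norm (mpinv A) * enorm (A *m x).
Proof.
by move=> rA; rewrite -{1}[x]mul1mx -(mpinv_mulVmx _ rA) -mulmxA enorm_mulmx.
Qed.

Lemma orthonormal_basis_rangeP (A Q : 'M[R]_(m, n)) : orthonormal_basis_range A Q ->
  (exists M, Q = A *m M) /\ (forall x : 'cV_n, exists y, A *m x = Q *m y).
Proof.
move=> [_ /andP[/submxP[D QD] /submxP[E AE]]]; split=> [|x].
  by exists D^T; rewrite -[Q]trmxK QD trmx_mul trmxK.
by exists (E^T *m x); rewrite -[A]trmxK AE trmx_mul trmxK mulmxA.
Qed.

(** Each projector fixes the range of the other: [Q Q^T A = A] and [A A^+ Q = Q]. Transposing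
    [Q Q^T A A^+ = A A^+] and using symmetry gives equality. *)
Lemma proj_mpinv (A Q : 'M[R]_(m, n)) : orthonormal_basis_range A Q -> A *m mpinv A = Q *m Q^T.
Proof.
move=> QA; have [QQ _] := QA; have [[M QE] AQ] := orthonormal_basis_rangeP _ _ QA.
have [A1 _ A3 _] := mpinvP A.
have AE : Q *m Q^T *m A = A.
  apply: mulmx_cV_inj => x; rewrite -mulmxA; have [y ->] := AQ x.
  by rewrite mulmxA -(mulmxA Q) QQ mulmx1.
have QQA : A *m mpinv A *m Q = Q by rewrite {1 2}QE mulmxA A1.
rewrite -A3 -{1}AE -(mulmxA _ A) trmx_mul A3 trmx_mul trmxK.
by rewrite mulmxA QQA.
Qed.

Lemma enorm_proj_compl_le (Q : 'M[R]_(m, n)) x : Q^T *m Q = 1%:M ->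
  enorm (x - Q *m (Q^T *m x)) <= enorm x.
Proof.
move=> QQ; rewrite -(@ler_pXn2r _ 2) ?nnegrE ?enorm_ge0 //.
by rewrite enorm_proj_compl // lerBlDr lerDl sqr_ge0.
Qed.

(** * Rank and range under a small perturbation *)

Section SmallPerturbation.
Context (A dA : 'M[R]_(m, n)) (rankA : \rank A = n)
  (dA_small : spectral_norm dA * spectral_norm (mpinv A) <= 1 / 2).

Lemma enorm_mul_dA x : enorm (dA *m x) <= 1 / 2 * enorm (A *m x).
Proof.
apply: (le_trans (enorm_mulmx _ _ _ _)).
apply: (le_trans (ler_wpM2l (spectral_norm_ge0 _ _ dA) (enorm_le_mpinv A x rankA))).
by rewrite mulrA ler_wpM2r ?enorm_ge0.
Qed.

(** Triangle inequality, with the half of [|A x|] coming from [dA] absorbed on the left. *)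
Lemma enorm_mul_perturbed x : enorm (A *m x) <= 2 * enorm ((A + dA) *m x).
Proof.
have : enorm (A *m x) <= enorm ((A + dA) *m x) + enorm (dA *m x).
  by rewrite -(enormN _ (dA *m x)) (le_trans _ (ler_enormD _ _ _)) //
    mulmxDl addrK.
by have := enorm_mul_dA x; lra.
Qed.

(** A kernel vector of [A + dA] is killed by [A] as well, hence is zero. *)
Lemma rank_perturbed : \rank (A + dA)%R = n.
Proof.
rewrite -mxrank_tr; apply/eqP; rewrite -/(row_free _) -kermx_eq0.
apply/eqP/row_matrixP => i; rewrite row0; apply: trmx_inj; rewrite trmx0.
set z := (row _ _)^T.
have Bz : (A + dA) *m z = 0.
  by rewrite -[A + dA]trmxK -trmx_mul -row_mul mulmx_ker row0 trmx0.
have := enorm_mul_perturbed z; rewrite Bz enorm0 mulr0 => Az.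
have {}Az : enorm (A *m z) = 0 by apply/eqP; rewrite eq_le Az enorm_ge0.
apply: enorm_eq0; apply/eqP; rewrite eq_le enorm_ge0 andbT.
by have := enorm_le_mpinv A z rankA; rewrite Az mulr0.
Qed.

Context (Q P : 'M[R]_(m, n)) (QA : orthonormal_basis_range A Q)
  (PA : orthonormal_basis_range (A + dA) P).

Lemma proj_dist_le x : enorm (Q *m x - P *m (P^T *m (Q *m x)))
  <= spectral_norm dA * spectral_norm (mpinv A) * enorm x.
Proof.
have [[M QE] _] := orthonormal_basis_rangeP _ _ QA.
have [_ BP] := orthonormal_basis_rangeP _ _ PA.
have [QQ _] := QA; have [PP _] := PA.
pose z := M *m x.
have Qx : Q *m x = A *m z by rewrite QE mulmxA.
have [y yE] := BP z.
(* The part [P y] lies in range(A + dA), so [I - P P^T] leaves only the [dA z] term. *)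
have Az : A *m z = P *m y - dA *m z by rewrite -yE mulmxDl addrK.
have -> : Q *m x - P *m (P^T *m (Q *m x))
    = - (dA *m z - P *m (P^T *m (dA *m z))).
  rewrite Qx Az !mulmxBr (mulmxA P^T P) PP mul1mx.
  by rewrite !opprB addrC addrA subrK.
rewrite enormN (le_trans (enorm_proj_compl_le _ _ PP)) //.
rewrite (le_trans (enorm_mulmx _ _ _ _)) // -mulrA ler_wpM2l ?spectral_norm_ge0 //.
by rewrite -(enorm_isometry _ _ Q x QQ) Qx enorm_le_mpinv.
Qed.

Lemma proj_dist_perp_le x : enorm (P *m x - Q *m (Q^T *m (P *m x)))
  <= 2 * (spectral_norm ((1%:M - A *m mpinv A) *m dA)
          * spectral_norm (mpinv A)) * enorm x.
Proof.
have [[M PE] _] := orthonormal_basis_rangeP _ _ PA.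
have [PP _] := PA.
pose z := M *m x.
have Px : P *m x = (A + dA) *m z by rewrite PE mulmxA.
have [A1 _ _ _] := mpinvP A.
have -> : P *m x - Q *m (Q^T *m (P *m x))
    = (1%:M - A *m mpinv A) *m dA *m z.
  rewrite (mulmxA Q) -(proj_mpinv _ _ QA) Px -[X in X - _]mul1mx -mulmxBl mulmxA.
  by rewrite mulmxDr mulmxBl A1 mul1mx subrr add0r.
rewrite (le_trans (enorm_mulmx _ _ _ _)) //.
rewrite [2 * _]mulrC -!mulrA ler_wpM2l ?spectral_norm_ge0 //.
(* [|z| <= |A^+| |A z| <= 2 |A^+| |(A + dA) z|], and the last norm is [|x|]. *)
rewrite (le_trans (enorm_le_mpinv A z rankA)) //.
rewrite ler_wpM2l ?spectral_norm_ge0 //.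
by rewrite (le_trans (enorm_mul_perturbed z)) // -Px enorm_isometry.
Qed.

End SmallPerturbation.
End Perturbation.

(** * From absolute to relative bounds on leverage scores *)

Lemma relative_bound (R : realType) (l lt s : R) : 0 < l -> l <= 1 ->
  `|lt - l| <= 2 * Num.sqrt (l * (1 - l)) * s + s ^+ 2 ->
  `|lt - l| / l <= (2 * Num.sqrt ((1 - l) / l) + s / l) * s.
Proof.
move=> l0 l1; have -> : Num.sqrt (l * (1 - l)) = l * Num.sqrt ((1 - l) / l).
  rewrite -[X in _ = X * _](ger0_norm (ltW l0)) -sqrtr_sqr -sqrtrM ?sqr_ge0 //.
  by congr Num.sqrt; field; rewrite gt_eqF.
rewrite ler_pdivrMr // => /le_trans; apply.
by rewrite le_eqVlt; apply/orP; left; apply/eqP; field; rewrite gt_eqF.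
Qed.

Theorem theorem2p4 (R : realType) (m n : nat) (A dA : 'M[R]_(m, n))
    (rankA : \rank A = n)
    (dA_small : spectral_norm dA * spectral_norm (mpinv A) <= 1 / 2) :
  let eps := spectral_norm dA / spectral_norm A in
  let epsperp :=
    spectral_norm ((1%:M - A *m mpinv A) *m dA) / spectral_norm A in
  let kappa := cond2 A in
  forall j : 'I_m,
  let l := leverage A j in
  let lt := leverage (A + dA) j in
  0 < l ->
  `|lt - l| / l
    <= 4 * (Num.sqrt ((1 - l) / l) + kappa / l * epsperp) * kappa * epsperp
  /\
  `|lt - l| / l
    <= (2 * Num.sqrt ((1 - l) / l) + kappa / l * eps) * kappa * eps.
Proof.
move=> eps epsperp kappa j l lt l0.
have [Q QA] := orthonormal_basis_range_exists rankA.
have [P PA] := orthonormal_basis_range_exists (rank_perturbed _ _ rankA dA_small).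
have [QQ _] := QA; have [PP _] := PA.
pose e : 'cV[R]_m := delta_mx j 0.
have e1 : enorm e = 1.
  apply/eqP; rewrite -(@eqrXn2 _ 2) ?enorm_ge0 // -dotvv /dotv trmx_delta.
  by rewrite mul_delta_mx mxE !eqxx expr1n.
have lE : l = enorm (Q^T *m e) ^+ 2 by rewrite /l (leverageE _ QA) tr_row colE.
have ltE : lt = enorm (P^T *m e) ^+ 2 by rewrite /lt (leverageE _ PA) tr_row colE.
(* If [|A| = 0] then [Q = A M = 0] and [l = 0]; so [|A|] can be cancelled in [kappa * eps]. *)
have A0 : spectral_norm A != 0.
  apply: contraTN l0 => /eqP /spectral_norm_eq0 A0; rewrite lE.
  have [[M ->] _] := orthonormal_basis_rangeP _ _ QA.
  by rewrite A0 mul0mx trmx0 mul0mx enorm0 expr0n ltxx.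
have kE t : kappa * (t / spectral_norm A) = t * spectral_norm (mpinv A).
  by rewrite /kappa /cond2; field.
have bound s (s0 : 0 <= s) hs := proj_norm_diff P Q s e s0 PP QQ e1 hs.
split.
(* The 2 in [s] enters both factors of [(2 r + s / l) s], hence the constant 4. *)
- pose s := 2 * (kappa * epsperp).
  have sE : s = 2 * (spectral_norm ((1%:M - A *m mpinv A) *m dA)
          * spectral_norm (mpinv A)) by rewrite /s /epsperp kE.
  have s0 : 0 <= s by rewrite sE !mulr_ge0 ?spectral_norm_ge0.
  have [|l1 b] := bound _ s0.
    (* The available estimate is for [(I - Q Q^T) P]; equal dimensions turn it into the one for
       [(I - P P^T) Q]. *)
    apply: (proj_dist_sym _ _ _ s0 QQ PP) => x; rewrite sE.
    exact: proj_dist_perp_le.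
  move: l1 b; rewrite -lE -ltE => l1 /(relative_bound _ _ _ _ l0 l1) /le_trans; apply.
  by rewrite le_eqVlt; apply/orP; left; apply/eqP; rewrite /s; ring.
- pose s := kappa * eps.
  have sE : s = spectral_norm dA * spectral_norm (mpinv A) by rewrite /s /eps kE.
  have s0 : 0 <= s by rewrite sE !mulr_ge0 ?spectral_norm_ge0.
  have [|l1 b] := bound _ s0; first by move=> x; rewrite sE; exact: proj_dist_le.
  move: l1 b; rewrite -lE -ltE => l1 /(relative_bound _ _ _ _ l0 l1) /le_trans; apply.
  by rewrite le_eqVlt; apply/orP; left; apply/eqP; rewrite /s; ring.
Qed.
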